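(* Let $F_1,\dots,F_r:\mathbb{R}^n\to\mathbb{R}$ be the continuously differentiable residual functions of the LOVO problem with $p$ trusted points, $1\le p\le r$, and let $f_1,\dots,f_q$ and $f_{min}$ be the associated functions. Let $x_0\in\mathbb{R}^n$ be arbitrary and assume that the level set $C(x_0)=\{x\in\mathbb{R}^n \mid f_{min}(x)\le f_{min}(x_0)\}$ is bounded and that each $f_i$, $i=1,\dots,q$, has a Lipschitz continuous gradient with Lipschitz constant $L_i>0$ in an open set containing $C(x_0)$. Let $\{x_k\}_{k\in\mathbb{N}}$ be an (infinite) sequence generated by Algorithm LM-LOVO from $x_0$, with selected indices $i_k\in I_{min}(x_k)$. Let $i\in\{1,\dots,q\}$ be such that $\mathcal{K}'=\{k\in\mathbb{N} \mid i_k=i\}$ is infinite. Then $$\lim_{k\in\mathcal{K}',\,k\to\infty}\|\nabla f_i(x_k)\|_2=0.$$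
   Context: Setting. Data points $(t_i,y_i)\in\mathbb{R}^m\times\mathbb{R}$, $i=1,\dots,r$, and a model $\phi(x,t)$ with parameters $x\in\mathbb{R}^n$ are given. Put $F_i(x)=y_i-\phi(x,t_i)$, assumed continuously differentiable on $\mathbb{R}^n$, and $R_i(x)=\frac12 F_i(x)^2$. Fix an integer $p$ with $1\le p\le r$. Let $\mathcal{C}_1,\dots,\mathcal{C}_q$ be all the subsets of $\{1,\dots,r\}$ with exactly $p$ elements. For $i=1,\dots,q$ let $F_{\mathcal{C}_i}:\mathbb{R}^n\to\mathbb{R}^p$ be the map with components $F_k$, $k\in\mathcal{C}_i$ (in any fixed order), let $J_{\mathcal{C}_i}(x)$ be its Jacobian, and define $$f_i(x)=\sum_{k\in\mathcal{C}_i}R_k(x)=\tfrac12\|F_{\mathcal{C}_i}(x)\|_2^2,\qquad f_{min}(x)=\min\{f_i(x)\mid i=1,\dots,q\}.$$ Thus $\nabla f_i(x)=J_{\mathcal{C}_i}(x)^TF_{\mathcal{C}_i}(x)$. The LOVO problem is to minimize $f_{min}$ over $\mathbb{R}^n$. Define $I_{min}(x)=\{i\in\{1,\dots,q\}\mid f_{min}(x)=f_i(x)\}$. Algorithm LM-LOVO. Inputs: $x_0\in\mathbb{R}^n$, $\lambda_{min}>0$, $\lambda_0>0$, $\epsilon\ge 0$, $\overline{\lambda}>1$, $\mu\in(0,1)$, and $p$. Set $k\leftarrow0$. Step 1: Select any $i_k\in I_{min}(x_k)$ and set $\lambda\leftarrow\lambda_k$. Step 2: If $\|\nabla f_{i_k}(x_k)\|_2<\epsilon$,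 stop. Step 3: Set $\gamma_k\leftarrow\lambda\|\nabla f_{i_k}(x_k)\|_2^2$. Compute $d_k$ as the solution $d$ of $$(J_{\mathcal{C}_{i_k}}(x_k)^TJ_{\mathcal{C}_{i_k}}(x_k)+\gamma_kI)\,d=-\nabla f_{i_k}(x_k).$$ Compute $$\rho_{k,i_k}=\frac{f_{min}(x_k)-f_{min}(x_k+d_k)}{m_{k,i_k}(0)-m_{k,i_k}(d_k)},\qquad m_{k,i}(d)=\tfrac12\|F_{\mathcal{C}_i}(x_k)+J_{\mathcal{C}_i}(x_k)d\|_2^2+\tfrac{\gamma_k}{2}\|d\|_2^2.$$ Step 4: If $\rho_{k,i_k}<\mu$, set $\lambda\leftarrow\overline{\lambda}\lambda$ and go back to Step 3. Otherwise go to Step 5. Step 5: Choose any $\lambda_{k+1}\in[\max\{\lambda_{min},\lambda/\overline{\lambda}\},\lambda]$, set $x_{k+1}\leftarrow x_k+d_k$, $k\leftarrow k+1$, and go to Step 1. An infinite sequence generated by the algorithm is one for which the stopping test in Step 2 never triggers and, at every iteration, Step 5 is reached (in particular all the quantities in Step 3 are well defined); $\epsilon=0$ corresponds to running the algorithm without a stopping test. *)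

(* Defs.v *)
From HB Require Import structures.
From mathcomp Require Import all_boot all_order all_algebra.
From mathcomp Require Import all_classical all_reals all_analysis.
Import Order.TTheory GRing.Theory Num.Theory.
Import numFieldNormedType.Exports.

Set Implicit Arguments.
Unset Strict Implicit.
Unset Printing Implicit Defensive.

Local Open Scope classical_set_scope.
Local Open Scope ring_scope.

(* The library norm on matrices is the sup norm, hence this definition. *)
Definition norm2 (R : realType) (n : nat) (v : 'rV[R]_n) : R :=
  Num.sqrt (\sum_(j < n) v 0 j ^+ 2).

Definition grad (R : realType) (n : nat) (f : 'rV[R]_n -> R) (x : 'rV[R]_n) :
    'rV[R]_n :=
  \row_(j < n) 'D_(delta_mx 0 j) f x.

Definition C1 (R : realType) (n : nat) (f : 'rV[R]_n -> R) : Prop :=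
  (forall x, differentiable f x) /\ continuous (grad f).

Definition lipschitz2_on (R : realType) (n : nat) (U : set 'rV[R]_n)
    (L : R) (g : 'rV[R]_n -> 'rV[R]_n) : Prop :=
  forall u v, U u -> U v -> norm2 (g u - g v) <= L * norm2 (u - v).

(* There is at least one p-subset when p <= r, so their number is written q.+1;
   this provides the seed of the minimum in [fmin]. *)
Definition enum_psubsets (r p q : nat) (C : 'I_q.+1 -> {set 'I_r}) : Prop :=
  injective C /\ forall S : {set 'I_r}, (#|S| = p) <-> (exists i, C i = S).

Section LOVO.
Context (R : realType) (n r q : nat).
Context (F : 'I_r -> 'rV[R]_n -> R) (C : 'I_q.+1 -> {set 'I_r}).

Definition Rsq (k : 'I_r) (x : 'rV[R]_n) : R := 2^-1 * F k x ^+ 2.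

Definition fsum (i : 'I_q.+1) (x : 'rV[R]_n) : R := \sum_(k in C i) Rsq k x.

Definition fmin (x : 'rV[R]_n) : R :=
  \big[Num.min/fsum ord0 x]_(i < q.+1) fsum i x.

Definition Imin (x : 'rV[R]_n) : set 'I_q.+1 := [set i | fmin x = fsum i x].

Definition FC (i : 'I_q.+1) (x : 'rV[R]_n) : 'rV[R]_#|C i| :=
  \row_(j < #|C i|) F (enum_val j) x.

(* The library's ['J] acts on row vectors from the right: it is the transpose
   of the usual Jacobian. *)
Definition JC (i : 'I_q.+1) (x : 'rV[R]_n) : 'M[R]_(#|C i|, n) :=
  ('J (FC i) x)^T.

Definition lm_gamma (i : 'I_q.+1) (x : 'rV[R]_n) (lam : R) : R :=
  lam * norm2 (grad (fsum i) x) ^+ 2.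

Definition lm_matrix (i : 'I_q.+1) (x : 'rV[R]_n) (lam : R) : 'M[R]_n :=
  (JC i x)^T *m JC i x + (lm_gamma i x lam)%:M.

Definition lm_model (i : 'I_q.+1) (x : 'rV[R]_n) (lam : R) (d : 'rV[R]_n) : R :=
  2^-1 * norm2 (FC i x + (JC i x *m d^T)^T) ^+ 2
  + lm_gamma i x lam / 2 * norm2 d ^+ 2.

Definition lm_rho (i : 'I_q.+1) (x : 'rV[R]_n) (lam : R) (d : 'rV[R]_n) : R :=
  (fmin x - fmin (x + d)) / (lm_model i x lam 0 - lm_model i x lam d).

(* Division by zero being total, the well-definedness of the linear system and
   of rho is stated explicitly. *)
Definition lm_trial (i : 'I_q.+1) (x : 'rV[R]_n) (lam : R) (d : 'rV[R]_n) :
    Prop :=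
  [/\ lm_matrix i x lam \in unitmx,
      lm_matrix i x lam *m d^T = - (grad (fsum i) x)^T &
      lm_model i x lam 0 - lm_model i x lam d != 0].

(* [lm_inner lbar mu i x lam lam' d]: started with damping [lam], the loop
   that rejects the trials with rho < mu ends with damping [lam'] and step [d]. *)
Inductive lm_inner (lbar mu : R) (i : 'I_q.+1) (x : 'rV[R]_n) :
    R -> R -> 'rV[R]_n -> Prop :=
| LMAccept (lam : R) (d : 'rV[R]_n) :
    lm_trial i x lam d -> mu <= lm_rho i x lam d ->
    lm_inner lbar mu i x lam lam d
| LMReject (lam : R) (d : 'rV[R]_n) (lam' : R) (d' : 'rV[R]_n) :
    lm_trial i x lam d -> lm_rho i x lam d < mu ->
    lm_inner lbar mu i x (lbar * lam) lam' d' ->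
    lm_inner lbar mu i x lam lam' d'.

(* [ik k] is the selected index at iterate [x k]. The stopping test
   never holds and every inner loop ends, i.e. the run is infinite. *)
Definition LM_LOVO_sequence (lmin lam0 eps lbar mu : R) (x0 : 'rV[R]_n)
    (x : nat -> 'rV[R]_n) (lam : nat -> R) (ik : nat -> 'I_q.+1) : Prop :=
  [/\ x 0%N = x0, lam 0%N = lam0 &
  forall k,
    [/\ Imin (x k) (ik k),
        ~ (norm2 (grad (fsum (ik k)) (x k)) < eps) &
        exists (lam' : R) (d : 'rV[R]_n),
          [/\ lm_inner lbar mu (ik k) (x k) (lam k) lam' d,
              Num.max lmin (lam' / lbar) <= lam k.+1 <= lam' &
              x k.+1 = x k + d]]].

End LOVO.

(* Main.v *)
Require Import Defs.
From HB Require Import structures.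
From mathcomp Require Import all_boot all_order all_algebra.
From mathcomp Require Import all_classical all_reals all_analysis.
From mathcomp Require Import ring lra.
Import Order.TTheory GRing.Theory Num.Theory.
Import numFieldNormedType.Exports.
Local Open Scope classical_set_scope.
Local Open Scope ring_scope.

Set Implicit Arguments.
Unset Strict Implicit.
Unset Printing Implicit Defensive.

(* Write a_k for the norm of the gradient of f_(i_k) at x_k. In fact a_k tends
   to 0 along the whole sequence, whatever the selected indices are.
   A trial at x with damping lam has predicted decrease M at least
   gamma |d|^2 / 2, and it can be rejected only if d is long or gamma <= 2L, so
   as long as a_k >= delta/2 the damping stays bounded. It need not be bounded
   overall, since small gradients of other selected functions can inflate it;
   hence a large a_k does not at once force a large decrease.
   The way out is that switching indices cannot make the gradient drop quickly.
   If j is selected at x + d and i at x, then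
     f_j(x + d) - f_j(x) <= f_i(x + d) - f_i(x),
   and since d is nearly parallel to -grad f_i(x) this gives
     a_(k+1) >= a_k - D |d_k|.
   Moreover the decrease of fmin is at least c |d_k| while a_k >= delta/2. The
   total decrease available after a late index k is tiny, so a_k >= delta
   implies a_l >= delta/2 for all l >= k; then the damping is bounded, the steps
   are bounded below, and fmin decreases by a fixed amount forever. *)

(** * Euclidean inner product, norm and gradients *)

Definition dot {R : realType} {n : nat} (u v : 'rV[R]_n) : R := (u *m v^T) 0 0.

Section Euclid.
Context (R : realType).
Implicit Types n m : nat.

Lemma dotE n (u v : 'rV[R]_n) : dot u v = \sum_j u 0 j * v 0 j.
Proof. by rewrite /dot mxE; apply: eq_bigr => j _; rewrite mxE. Qed.

Lemma dotC n (u v : 'rV[R]_n) : dot u v = dot v u.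
Proof. by rewrite !dotE; apply: eq_bigr => j _; rewrite mulrC. Qed.

Lemma dotDl n (u v w : 'rV[R]_n) : dot (u + v) w = dot u w + dot v w.
Proof. by rewrite /dot mulmxDl mxE. Qed.

Lemma dotZl n c (u v : 'rV[R]_n) : dot (c *: u) v = c * dot u v.
Proof. by rewrite /dot -scalemxAl mxE. Qed.

Lemma dotNl n (u v : 'rV[R]_n) : dot (- u) v = - dot u v.
Proof. by rewrite /dot mulNmx mxE. Qed.

Lemma dotBl n (u v w : 'rV[R]_n) : dot (u - v) w = dot u w - dot v w.
Proof. by rewrite dotDl dotNl. Qed.

Lemma norm2_ge0 n (v : 'rV[R]_n) : 0 <= norm2 v.
Proof. exact: sqrtr_ge0. Qed.

Lemma norm2_sqr n (v : 'rV[R]_n) : norm2 v ^+ 2 = dot v v.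
Proof.
rewrite dotE sqr_sqrtr; last by apply: sumr_ge0 => j _; rewrite sqr_ge0.
by apply: eq_bigr => j _; rewrite expr2.
Qed.

Lemma norm2_sqrD n (u v : 'rV[R]_n) :
  norm2 (u + v) ^+ 2 = norm2 u ^+ 2 + 2 * dot u v + norm2 v ^+ 2.
Proof.
rewrite !norm2_sqr dotDl (dotC u) (dotC v) !dotDl (dotC v u); ring.
Qed.

Lemma norm2Z n c (v : 'rV[R]_n) : norm2 (c *: v) = `|c| * norm2 v.
Proof.
apply/eqP; rewrite -(@eqrXn2 _ 2) ?mulr_ge0 ?norm2_ge0//.
rewrite exprMn !norm2_sqr dotZl dotC dotZl real_normK ?num_real//.
by rewrite expr2 mulrA.
Qed.

Lemma dot_norm n (u v : 'rV[R]_n) : `|dot u v| <= norm2 u * norm2 v.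
Proof.
have [u0|u0] := eqVneq (norm2 u) 0.
  have : norm2 u ^+ 2 = 0 by rewrite u0 expr0n.
  rewrite norm2_sqr dotE => /eqP; rewrite psumr_eq0; last first.
    by move=> j _; rewrite -expr2 sqr_ge0.
  move=> /allP E; suff -> : u = 0.
    by rewrite /dot mul0mx mxE normr0 mulr_ge0 ?norm2_ge0.
  apply/rowP => j; rewrite mxE; have := E j (mem_index_enum _).
  by rewrite implyTb mulf_eq0 orbb => /eqP.
have up : 0 < norm2 u ^+ 2 by rewrite exprn_gt0// lt_neqAle eq_sym u0 norm2_ge0.
rewrite -(@ler_pXn2r _ 2) ?nnegrE ?mulr_ge0 ?norm2_ge0//.
rewrite real_normK ?num_real// exprMn.
(* Cauchy-Schwarz: up to the factor [norm2 u ^+ 2], this vector is the component of [v] orthogonal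
   to [u]. *)
have := sqr_ge0 (norm2 (norm2 u ^+ 2 *: v + (- dot u v) *: u)).
rewrite norm2_sqrD !norm2Z dotZl (dotC v) dotZl !exprMn.
rewrite !real_normK ?num_real//.
have -> : (norm2 u ^+ 2) ^+ 2 * norm2 v ^+ 2 +
    2 * (norm2 u ^+ 2 * (- dot u v * dot u v)) +
    (- dot u v) ^+ 2 * norm2 u ^+ 2 =
    norm2 u ^+ 2 * (norm2 u ^+ 2 * norm2 v ^+ 2 - dot u v ^+ 2) by ring.
by rewrite pmulr_rge0// subr_ge0.
Qed.

Lemma normr_le_norm2 n (v : 'rV[R]_n) : `|v| <= norm2 v.
Proof.
rewrite [leLHS]/Num.Def.normr/= mx_normrE.
apply: bigmax_le => [|[i j] _ /=]; first exact: norm2_ge0.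
rewrite -(@ler_pXn2r _ 2) ?nnegrE ?norm2_ge0// norm2_sqr dotE (bigD1 j)//=.
rewrite (ord1 i) real_normK ?num_real// expr2 lerDl.
by apply: sumr_ge0 => k _; rewrite -expr2 sqr_ge0.
Qed.

Lemma dot_gram m n (A : 'M[R]_(m, n)) (u v : 'rV[R]_n) :
  (u *m (A^T *m A *m v^T)) 0 0 = dot (A *m u^T)^T (A *m v^T)^T.
Proof. by rewrite /dot !trmx_mul !trmxK !mulmxA. Qed.

Lemma derive_grad n (f : 'rV[R]_n -> R) (x v : 'rV[R]_n) :
  differentiable f x -> 'D_v f x = dot (grad f x) v.
Proof.
move=> df; rewrite deriveE// {1}(row_sum_delta v) linear_sum dotE.
apply: eq_bigr => j _.
by rewrite linearZ/= mxE -deriveE// mulrC.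
Qed.

(** The mean value theorem on the segment gives the increment as a slope at some [c] in (0,1);
    moving from [c] to [s0] costs at most [L * norm2 d] in the gradient. The point [s0] is left free
    because both ends of the segment are used: 0 for the old index, 1 for the new one. *)
Lemma gradient_estimate n (f : 'rV[R]_n -> R) (U : set 'rV[R]_n) (L s0 : R)
    (x d : 'rV[R]_n) :
  (forall z, differentiable f z) -> 0 <= L -> lipschitz2_on U L (grad f) ->
  0 <= s0 <= 1 -> (forall s, 0 <= s <= 1 -> U (x + s *: d)) ->
  `|f (x + d) - f x - dot (grad f (x + s0 *: d)) d| <= L * norm2 d ^+ 2.
Proof.
move=> df L0 lipf s01 Ud.
pose phi (s : R) := f (x + s *: d).
have dphi (s : R) : is_derive s (1 : R) phi (dot (grad f (x + s *: d)) d).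
  rewrite -derive_grad//.
  have E : (fun h : R => h^-1 *: (phi (h *: (1 : R) + s) - phi s)) =
           (fun h : R => h^-1 *: (f (h *: d + (x + s *: d)) - f (x + s *: d))).
    apply/funext => h; rewrite /phi; congr (_ *: (f _ - _)).
    by rewrite [h *: 1]mulr1 scalerDl addrCA.
  have D : derivable f (x + s *: d) d by exact: diff_derivable.
  by apply: DeriveDef; rewrite /derivable /derive /= E.
have cphi : {within `[0, 1], continuous phi}.
  apply: continuous_subspaceT => s; apply/differentiable_continuous.
  by apply/derivable1_diffP; exact: ex_derive.
have [c] := @MVT R phi (fun s => dot (grad f (x + s *: d)) d) 0 1 ltr01
  (fun s _ => dphi s) cphi.
rewrite in_itv/= => /andP[c0 c1].
rewrite /phi scale1r scale0r addr0 subr0 mulr1 => ->.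
rewrite -dotBl; apply: le_trans (dot_norm _ _) _.
rewrite expr2 mulrA ler_wpM2r ?norm2_ge0//.
apply: le_trans (lipf _ _ _ _) _; try by apply: Ud => //; lra.
rewrite ler_wpM2l// opprD addrACA subrr add0r -scalerBl norm2Z.
rewrite ler_piMl ?norm2_ge0// ler_norml; lra.
Qed.

End Euclid.

(** * Compactness and the abstract descent argument *)

(** Stated with a filter so that the radii for finitely many open sets can be taken in common. *)
Lemma compact_thickening (R : realType) (V : normedModType R) (K U : set V) :
  compact K -> open U -> K `<=` U ->
  \forall e \near (0 : R)^'+, forall z w, K z -> `|z - w| < e -> U w.
Proof.
move=> /compact_near_coveringP cK oU KU.
pose P (e : R) (z : V) := forall w, `|z - w| < e -> U w.
suff : \forall e \near (0 : R)^'+, K `<=` P e.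
  by apply: filterS => e H z w Kz; exact: H.
apply: cK => z Kz.
have /nbhs_ballP[r /= r0 rU] : nbhs z U.
  by apply: open_nbhs_nbhs; split=> //; exact: KU.
have r2 : 0 < r / 2 by rewrite divr_gt0.
near=> z' e; move=> w ze; apply: rU.
rewrite -ball_normE /ball_/=.
rewrite -(subrKA z') (le_lt_trans (ler_normD _ _))// (splitr r) ltrD//.
apply: lt_le_trans ze _ => /=.
near: e; exact: nbhs_right_le.
Unshelve. all: by end_near. Qed.

(** Isolates the real sequences: [a] gradient norms, [s] step lengths, [f] values of [fmin], [lam]
    dampings. All bounds are assumed only while [a k] is at least [delta / 2], and [Lam] stays
    arbitrary because the cap depends on the damping at the late index where the argument starts. *)
Lemma eventually_small_of_descent (R : realType) (a s f lam : nat -> R)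
    (delta c eta D Lam0 A B : R) :
  0 < delta -> 0 < c -> 0 < eta -> 0 < D -> 0 <= Lam0 -> 0 <= A -> 0 < B ->
  (forall k, 0 <= f k) -> (forall k, f k.+1 <= f k) ->
  (forall k, delta / 2 <= a k -> c * s k <= f k - f k.+1) ->
  (forall k, delta / 2 <= a k -> s k < eta -> a k - D * s k <= a k.+1) ->
  (forall k Lam, delta / 2 <= a k -> Lam0 <= Lam -> lam k <= Lam ->
     lam k.+1 <= Lam /\ a k <= (B + Lam * A) * s k) ->
  exists K, forall k, (K <= k)%N -> a k < delta.
Proof.
move=> delta0 c0 eta0 D0 Lam00 A0 B0 f0 fS Hdec Hlow Hlam.
have ndf : {homo f : n m / (n <= m)%N >-> m <= n}.
  by apply/nonincreasing_seqP.
have fC e : 0 < e -> exists K, forall k l, (K <= k)%N -> f k - f l < e.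
  move=> e0; have lf : has_lbound (range f) by exists 0 => _ [n _ <-].
  have fi n : inf (range f) <= f n by apply: ge_inf => //; exists n.
  have cf := nonincreasing_cvgn ndf lf.
  have /cvgrPdist_lt /(_ e e0) [K _ HK] := cf.
  exists K => k l Kk; have := HK k Kk; rewrite /= distrC.
  rewrite ger0_norm ?subr_ge0// => H.
  by have := fi l; lra.
(* The first bound on the remaining decrease keeps every step below [eta], the second keeps the
   total drop of [a] below [delta / 2]. *)
have e0 : 0 < Num.min (c * eta) (c * (delta / 2) / D).
  by rewrite lt_min mulr_gt0//= divr_gt0// mulr_gt0// divr_gt0.
have [K HK] := fC _ e0.
exists K => k Kk; rewrite ltNge; apply/negP => ak.
have gap j :
    f k - f (k + j)%N < c * eta /\ D / c * (f k - f (k + j)%N) < delta / 2.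
  have := HK k (k + j)%N Kk; rewrite lt_min => /andP[-> H]; split=> //.
  rewrite -ltr_pdivlMl ?divr_gt0// invf_div.
  apply: lt_le_trans H _; rewrite le_eqVlt; apply/orP; left; apply/eqP.
  by field; lra.
(* Telescoped gradient drop: each [D * s] is paid for by [D / c] times the decrease of [f]. *)
have aj j : delta - D / c * (f k - f (k + j)%N) <= a (k + j)%N.
  elim: j => [|j IH]; first by rewrite addn0 subrr mulr0 subr0.
  have [g1 g2] := gap j; have [g3 g4] := gap j.+1.
  have aj2 : delta / 2 <= a (k + j)%N by lra.
  have Hd := Hdec _ aj2; rewrite -addnS in Hd.
  have fkj : f (k + j)%N <= f k by apply: ndf; rewrite leq_addr.
  have sj : s (k + j)%N < eta by rewrite -(ltr_pM2l c0); lra.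
  have := Hlow _ aj2 sj; rewrite -addnS.
  suff : D * s (k + j)%N <= D / c * (f (k + j)%N - f (k + j.+1)%N) by lra.
  by rewrite -mulrA ler_pM2l// ler_pdivlMl.
have aj2 j : delta / 2 <= a (k + j)%N.
  by have [_ g2] := gap j; have := aj j; lra.
pose Lam := Num.max Lam0 (lam k).
have Lam0L : Lam0 <= Lam by rewrite /Lam le_max lexx.
have lamj j : lam (k + j)%N <= Lam.
  elim: j => [|j IH]; first by rewrite addn0 /Lam le_max lexx orbT.
  by rewrite addnS; have [] := Hlam _ _ (aj2 j) Lam0L IH.
have M0 : 0 < B + Lam * A.
  by rewrite ltr_wpDr// mulr_ge0//; exact: le_trans Lam00 Lam0L.
(* With the damping capped by [Lam], every step is at least [delta / 2 / (B + Lam * A)] long, so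
   every iteration decreases [f] by at least this amount; convergence of [f] forbids it. *)
have e1 : 0 < c * (delta / 2 / (B + Lam * A)).
  by rewrite !(mulr_gt0, divr_gt0, invr_gt0).
have [K1 HK1] := fC _ e1.
have [_ H] := Hlam _ _ (aj2 K1) Lam0L (lamj K1).
have := HK1 (k + K1)%N (k + K1).+1 (leq_addl _ _).
apply/negP; rewrite -leNgt; apply: (le_trans _ (Hdec _ (aj2 K1))).
by rewrite ler_pM2l// ler_pdivrMr// [leRHS]mulrC; exact: le_trans (aj2 K1) H.
Qed.

(** * The least squares model and its trial step *)

Section Model.
Context (R : realType) (n r q : nat).
Context (F : 'I_r -> 'rV[R]_n -> R) (C : 'I_q.+1 -> {set 'I_r}).
Hypothesis dF : forall k x, differentiable (F k) x.

Lemma fsum_FC i x : fsum F C i x = 2^-1 * norm2 (FC F C i x) ^+ 2.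
Proof.
rewrite norm2_sqr dotE /fsum big_enum_val mulr_sumr.
by apply: eq_bigr => j _; rewrite /Rsq !mxE expr2.
Qed.

Lemma fsum_ge0 i x : 0 <= fsum F C i x.
Proof. by rewrite fsum_FC mulr_ge0 ?sqr_ge0. Qed.

Lemma fsum_sumfun i :
  fsum F C i = \sum_(j < #|C i|) (2^-1 \*: (F (enum_val j) ^+ 2)).
Proof.
apply/funext => x; rewrite /fsum big_enum_val fct_sumE.
by apply: eq_bigr => j _; rewrite /Rsq.
Qed.

Lemma differentiable_fsum i x : differentiable (fsum F C i) x.
Proof.
rewrite fsum_sumfun; apply: differentiable_sum => j.
by apply: differentiableZ; exact: differentiableX.
Qed.

Lemma differentiable_FC i x : differentiable (FC F C i) x.
Proof.
have -> : FC F C i = \sum_(j < #|C i|)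
    (fun z => F (enum_val j) z *: (delta_mx 0 j : 'rV[R]_#|C i|)).
  apply/funext => z; rewrite fct_sumE [LHS]row_sum_delta.
  by apply: eq_bigr => j _; rewrite mxE.
by apply: differentiable_sum => j; exact: differentiableZl.
Qed.

Definition JCv i x (v : 'rV[R]_n) : 'rV[R]_#|C i| := (JC F C i x *m v^T)^T.

Lemma JCv_coord i x v j : JCv i x v 0 j = dot (grad (F (enum_val j)) x) v.
Proof.
rewrite /JCv trmx_mul !trmxK -deriveEjacobian; last exact: differentiable_FC.
rewrite derive_mx; last exact/diff_derivable/differentiable_FC.
by rewrite mxE -derive_grad//; congr ('D_v _ x); apply/funext => z; rewrite mxE.
Qed.

(** The chain rule: the gradient is the transposed Jacobian applied to the residuals, here tested
    against [v]. *)
Lemma dot_grad_fsum i x v :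
  dot (grad (fsum F C i) x) v = dot (FC F C i x) (JCv i x v).
Proof.
rewrite -derive_grad; last exact: differentiable_fsum.
rewrite fsum_sumfun derive_sum; last first.
  by move=> j; apply/diff_derivable/differentiableZ/differentiableX.
rewrite dotE; apply: eq_bigr => j _.
have dFj : derivable (F (enum_val j)) x v by exact: diff_derivable.
rewrite deriveZ; last exact: derivableX.
rewrite deriveX// JCv_coord -derive_grad// mxE expr1 /GRing.scale/=.
by field.
Qed.

(** Cauchy-Schwarz on each row. Summing over all residuals, not only those in [C i], makes [B]
    independent of the selected index. *)
Lemma norm2_JCv i x v B :
  0 <= B -> \sum_k norm2 (grad (F k) x) ^+ 2 <= B ^+ 2 ->
  norm2 (JCv i x v) <= B * norm2 v.
Proof.
move=> B0 HB.
rewrite -(@ler_pXn2r _ 2) ?nnegrE ?mulr_ge0 ?norm2_ge0// exprMn.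
apply: (le_trans _ (ler_wpM2r (sqr_ge0 _) HB)).
have HC : \sum_(k in C i) norm2 (grad (F k) x) ^+ 2 <=
    \sum_k norm2 (grad (F k) x) ^+ 2.
  rewrite [leLHS]big_mkcond/=.
  by apply: ler_sum => k _; case: ifP => // _; rewrite sqr_ge0.
apply: (le_trans _ (ler_wpM2r (sqr_ge0 _) HC)).
rewrite norm2_sqr dotE [X in _ <= X * _]big_enum_val mulr_suml.
apply: ler_sum => j _.
rewrite JCv_coord -expr2 -exprMn -real_normK ?num_real//.
by rewrite ler_pXn2r ?nnegrE ?mulr_ge0 ?norm2_ge0// dot_norm.
Qed.

Section Step.
Context (i : 'I_q.+1) (x : 'rV[R]_n) (lam : R) (d : 'rV[R]_n).
Hypothesis Hd : lm_trial F C i x lam d.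
Let g := grad (fsum F C i) x.
Let gam := lm_gamma F C i x lam.
Let J := JCv i x.

Lemma lm_normal_eq v : dot (J v) (J d) + gam * dot v d = - dot g v.
Proof.
have [_ E _] := Hd.
rewrite /J /JCv -dot_gram dotC [dot g v]dotC.
have -> : - dot v g = (v *m - g^T) 0 0 by rewrite mulmxN mxE.
rewrite -E /lm_matrix mulmxDl mulmxDr [in RHS]mxE mul_scalar_mx -scalemxAr.
by rewrite [X in _ = _ + X]mxE dotC.
Qed.

Lemma lm_dot_grad : dot g d = - (norm2 (J d) ^+ 2 + gam * norm2 d ^+ 2).
Proof. by rewrite !norm2_sqr lm_normal_eq opprK. Qed.

(** Expanding the square leaves the cross term [dot g d], which the linear system tested against [d]
    evaluates. *)
Lemma lm_model_decrease :
  lm_model F C i x lam 0 - lm_model F C i x lam d =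
  2^-1 * (norm2 (J d) ^+ 2 + gam * norm2 d ^+ 2).
Proof.
rewrite /lm_model -/gam trmx0 mulmx0 trmx0 addr0 -/(JCv i x d) norm2_sqrD.
rewrite -dot_grad_fsum -/g lm_dot_grad (norm2_sqr (0 : 'rV_n)).
rewrite /dot mul0mx mxE /J.
by field.
Qed.

(** Test the linear system against [g] itself and divide by [norm2 g]. *)
Lemma norm2_grad_le B : 0 <= B -> 0 <= gam ->
  (forall v, norm2 (J v) <= B * norm2 v) -> norm2 g <= (B ^+ 2 + gam) * norm2 d.
Proof.
move=> B0 gam0 HB.
have [->|g0] := eqVneq (norm2 g) 0.
  by rewrite mulr_ge0 ?norm2_ge0// addr_ge0 ?sqr_ge0.
have gp : 0 < norm2 g by rewrite lt_neqAle eq_sym g0 norm2_ge0.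
rewrite -(ler_pM2l gp) -expr2 norm2_sqr -[leLHS]opprK -lm_normal_eq.
have := dot_norm (J g) (J d); have := dot_norm g d.
rewrite !ler_norml => /andP[H1 _] /andP[H2 _].
have H3 : norm2 (J g) * norm2 (J d) <= (B * norm2 g) * (B * norm2 d).
  by apply: ler_pM; rewrite ?norm2_ge0.
have H4 : gam * - (norm2 g * norm2 d) <= gam * dot g d by rewrite ler_wpM2l.
by nra.
Qed.

End Step.
End Model.

Lemma continuous_bigsum (R : realType) (T : topologicalType) (I : finType)
    (f : I -> T -> R) :
  (forall i, continuous (f i)) -> continuous (fun z => \sum_i f i z).
Proof.
move=> cf z; apply: cvg_big => [|i _]; first exact: add_continuous.
exact: cf.
Qed.

(** If [b * d] is at most [delta / 4], then [gam * d] is at least [delta / 4]. Otherwise [d] exceeds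
    [delta / (4 * b)], and the lower bound on [gam] takes over. Either way [M] is at least linear in
    [d]. *)
Lemma model_growth (R : realType) (delta b l0 M gam a d : R) :
  0 < delta -> 0 < b -> 0 < l0 -> 0 <= d -> delta / 2 <= a ->
  a <= (b + gam) * d -> l0 * (delta / 2) ^+ 2 <= gam ->
  2^-1 * (gam * d ^+ 2) <= M ->
  Num.min (delta / 8) (l0 * delta ^+ 3 / (32 * b)) * d <= M.
Proof.
move=> delta0 b0 l00 d0 ad Hg gamd HM.
apply: le_trans HM.
have [H|H] := leP (b * d) (delta / 4).
  apply: (@le_trans _ _ (delta / 8 * d)).
    by rewrite ler_wpM2r// ge_min lexx.
  have : delta / 4 * d <= gam * d * d by rewrite ler_wpM2r//; lra.
  by rewrite expr2 mulrA; lra.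
apply: (@le_trans _ _ (l0 * delta ^+ 3 / (32 * b) * d)).
  by rewrite ler_wpM2r// ge_min lexx orbT.
have H1 : delta / (4 * b) <= d.
  by rewrite ler_pdivrMr ?mulr_gt0//; lra.
have H2 : l0 * (delta / 2) ^+ 2 * (delta / (4 * b)) <= gam * d.
  apply: ler_pM => //; last by rewrite divr_ge0 ?mulr_ge0// ltW.
  by rewrite mulr_ge0 ?sqr_ge0 ?ltW.
have H3 := ler_wpM2r d0 H2.
rewrite expr2 mulrA in H3 *.
suff -> : l0 * delta ^+ 3 / (32 * b) * d =
    2^-1 * (l0 * (delta / 2 * (delta / 2)) * (delta / (4 * b)) * d) by lra.
by field; lra.
Qed.

(** * The inner loop and the level set *)

Section Algorithm.
Context (R : realType) (n r q : nat).
Context (F : 'I_r -> 'rV[R]_n -> R) (C : 'I_q.+1 -> {set 'I_r}).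

Lemma fmin_le i x : fmin F C x <= fsum F C i x.
Proof. exact: bigmin_le. Qed.

Lemma fmin_ge0 x : 0 <= fmin F C x.
Proof. by apply: le_bigmin => [|i _]; exact: fsum_ge0. Qed.

(** The final damping is either the initial one or [lbar] times a rejected one, whence the last
    clause. *)
Lemma lm_inner_spec lbar mu i x lam lam' d :
  1 < lbar -> 0 < lam -> lm_inner F C lbar mu i x lam lam' d ->
  [/\ lam <= lam', lm_trial F C i x lam' d, mu <= lm_rho F C i x lam' d &
   forall Lam, lam <= Lam ->
     (forall l e, 0 < l -> lm_trial F C i x l e -> lm_rho F C i x l e < mu ->
       lbar * l <= Lam) -> lam' <= Lam].
Proof.
move=> lbar1 lam0 H.
elim: H lam0 => {lam lam' d} [lam d Ht Hr|lam d lam' d' Ht Hr _ IH] lam0.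
  by split.
have l0 : 0 < lbar * lam by rewrite mulr_gt0//; lra.
have [le1 Ht' Hr' HL] := IH l0; split => //.
  by apply: le_trans le1; rewrite ler_peMl ?ltW.
by move=> Lam _ H; apply: HL => //; exact: H Ht Hr.
Qed.

Hypothesis C1F : forall k, C1 (F k).

Let dF k x : differentiable (F k) x.
Proof. by have [+ _] := C1F k; apply. Qed.

(** A minimum is at most [c] exactly when one of its terms is, so the set is a finite union of
    closed sublevel sets. *)
Lemma closed_fmin_sublevel c : closed [set z | fmin F C z <= c].
Proof.
have -> : [set z | fmin F C z <= c] =
    \bigcup_(i in [set: 'I_q.+1]) [set z | fsum F C i z <= c].
  apply/seteqP; split => z /=.
    by move=> /bigmin_leP[H|[i _ H]]; [exists ord0|exists i].
  by move=> [i _ H]; exact: le_trans (fmin_le _ _) H.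
apply: closed_bigcup; first exact: finite_finset.
move=> i _; apply: (@closed_comp _ _ (fsum F C i) [set y | y <= c]).
  by move=> z _; apply/differentiable_continuous/differentiable_fsum.
exact: closed_le.
Qed.

Lemma grad_bound_compact (K : set 'rV[R]_n) : compact K ->
  exists2 B, 0 < B &
    forall z, K z -> \sum_k norm2 (grad (F k) z) ^+ 2 <= B ^+ 2.
Proof.
move=> cK; pose G z := \sum_k norm2 (grad (F k) z) ^+ 2.
have cG : continuous G.
  have -> : G = fun z => \sum_k \sum_j grad (F k) z 0 j ^+ 2.
    apply/funext => z; apply: eq_bigr => k _.
    by rewrite norm2_sqr dotE; apply: eq_bigr => j _; rewrite expr2.
  do 2 (apply: continuous_bigsum => ?).
  move=> z; apply: (@continuous_comp _ _ _ _ (fun y : R => y ^+ 2)).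
    apply: (@continuous_comp _ _ _ _ (fun M : 'rV[R]_n => M 0 _)).
      exact: (C1F _).2.
    exact: coord_continuous.
  exact: exprn_continuous.
have : compact (G @` K).
  by apply: continuous_compact => //; exact: continuous_subspaceT.
move=> /compact_bounded[M [_ HM]].
(* [B] must exceed [M] to be a bound, and be at least 1 so that it is below its square. *)
pose B := Num.max 1 (M + 1).
have B1 : 1 <= B by rewrite /B le_max lexx.
exists B; first lra.
move=> z Kz; have /= := HM B _ (G z).
have MB : M < B by rewrite /B lt_max ltrDl ltr01 orbT.
move=> /(_ MB) H.
have {}H : `|G z| <= B by apply: H; exists z.
apply: le_trans (ler_norm _) (le_trans H _).
by rewrite expr2 ler_peMl//; lra.
Qed.

(** * Estimates for a single trial step *)

Section Estimates.
Context (K : set 'rV[R]_n) (U : 'I_q.+1 -> set 'rV[R]_n) (L B eta : R).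
Hypotheses (L0 : 0 < L) (B0 : 0 < B) (eta0 : 0 < eta).
Hypothesis HU : forall i z w, K z -> norm2 (w - z) < eta -> U i w.
Hypothesis Hlip : forall i, lipschitz2_on (U i) L (grad (fsum F C i)).
Hypothesis HB : forall z, K z -> \sum_k norm2 (grad (F k) z) ^+ 2 <= B ^+ 2.

Lemma short_step_estimate j (s0 : R) x d :
  K x -> norm2 d < eta -> 0 <= s0 <= 1 ->
  `|fsum F C j (x + d) - fsum F C j x - dot (grad (fsum F C j) (x + s0 *: d)) d|
    <= L * norm2 d ^+ 2.
Proof.
move=> Kx de s01; apply: (gradient_estimate _ (ltW L0) (Hlip (i := j)) s01).
  by move=> z; exact: differentiable_fsum.
move=> s /andP[s0' s1]; apply: HU Kx _; rewrite addrC addKr norm2Z.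
apply: le_lt_trans de; rewrite ger0_norm//.
by rewrite ler_piMl// norm2_ge0.
Qed.

Section Trial.
Context (i : 'I_q.+1) (x : 'rV[R]_n) (lam : R) (d : 'rV[R]_n).
Hypotheses (Hd : lm_trial F C i x lam d) (lam_gt0 : 0 < lam).
Let g := grad (fsum F C i) x.
Let gam := lm_gamma F C i x lam.
Let M := lm_model F C i x lam 0 - lm_model F C i x lam d.

Let gam_ge0 : 0 <= gam.
Proof. by rewrite mulr_ge0 ?sqr_ge0 ?ltW. Qed.

Lemma lm_model_le : 2^-1 * (gam * norm2 d ^+ 2) <= M.
Proof.
by rewrite /M (lm_model_decrease dF Hd) ler_wpM2l// lerDr sqr_ge0.
Qed.

(** [lm_model_le] gives the sign, and the well-definedness of rho excludes zero. *)
Lemma lm_model_gt0 : 0 < M.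
Proof.
have [_ _ M0] := Hd; rewrite lt_neqAle eq_sym M0/=.
apply: le_trans lm_model_le; rewrite mulr_ge0// mulr_ge0// sqr_ge0//.
Qed.

Lemma lm_dot_model : dot g d = - (2 * M).
Proof. by rewrite (lm_dot_grad Hd) /M (lm_model_decrease dF Hd); field. Qed.

Lemma lm_step_gt0 : 0 < norm2 d.
Proof.
rewrite lt_neqAle eq_sym norm2_ge0 andbT; apply/eqP => d0.
have := lm_model_gt0; have := dot_norm g d.
by rewrite d0 mulr0 normr_le0 lm_dot_model => /eqP; lra.
Qed.

(** The two summands treat short and long steps. For a short one, rejection gives
    [2 * M - L * norm2 d ^+ 2 < M], hence [gam < 2 * L]. For a long one, [gam * norm2 d ^+ 2 <= 2 *
    M <= norm2 g * norm2 d] gives [lam * norm2 g * norm2 d <= 1]. *)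
Lemma lm_rejected_bound mu delta :
  K x -> Imin F C x i -> 0 < mu < 1 -> 0 < delta -> delta / 2 <= norm2 g ->
  lm_rho F C i x lam d < mu ->
  lam <= 8 * L / delta ^+ 2 + 2 / (delta * eta).
Proof.
move=> Kx Ii /andP[mu0 mu1] delta0 gd.
have M0 := lm_model_gt0; have d0 := lm_step_gt0.
rewrite /lm_rho ltr_pdivrMr// -/M => Hrho.
have gam2 : lam * (delta / 2) ^+ 2 <= gam.
  rewrite /gam /lm_gamma -/g ler_pM2l// ler_pXn2r ?nnegrE ?norm2_ge0//.
  by rewrite divr_ge0 ?ltW.
have T1 : 0 <= 8 * L / delta ^+ 2 by rewrite divr_ge0 ?sqr_ge0// mulr_ge0 ?ltW.
have T2 : 0 <= 2 / (delta * eta) by rewrite divr_ge0// mulr_ge0 ?ltW.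
have [de|de] := ltP (norm2 d) eta.
  have s01 : 0 <= (0 : R) <= 1 by lra.
  have := short_step_estimate i Kx de s01.
  rewrite scale0r addr0 -/g lm_dot_model ler_norml => /andP[_ H].
  have Hi : fmin F C x = fsum F C i x by exact: Ii.
  have Hi' := fmin_le i (x + d).
  have HM := lm_model_le.
  have muM : mu * M < M by rewrite gtr_pMl.
  have H1 : gam * norm2 d ^+ 2 < 2 * L * norm2 d ^+ 2 by lra.
  rewrite ltr_pM2r ?exprn_gt0// in H1.
  apply: (@le_trans _ _ (8 * L / delta ^+ 2)); last by rewrite lerDl.
  rewrite ler_pdivlMr ?exprn_gt0//.
  by move: gam2; rewrite expr_div_n; lra.
have g0 : 0 < norm2 g by lra.
have H1 : lam * norm2 g * norm2 d <= 1.
  have := dot_norm g d; rewrite lm_dot_model normrN ger0_norm; last by lra.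
  have HM := lm_model_le => H.
  have : gam * norm2 d ^+ 2 <= norm2 g * norm2 d by lra.
  rewrite /gam /lm_gamma -/g.
  have -> : lam * norm2 g ^+ 2 * norm2 d ^+ 2 =
      (lam * norm2 g * norm2 d) * (norm2 g * norm2 d) by ring.
  by rewrite ger_pMl// mulr_gt0.
apply: (@le_trans _ _ (2 / (delta * eta))); last by rewrite lerDr.
rewrite ler_pdivlMr ?mulr_gt0//.
have : lam * (delta / 2) * eta <= lam * norm2 g * norm2 d.
  have H2 : lam * (delta / 2) <= lam * norm2 g by rewrite ler_pM2l.
  apply: (le_trans (ler_wpM2r (ltW eta0) H2)).
  by rewrite ler_pM2l// mulr_gt0.
by lra.
Qed.

Hypothesis Kx : K x.

Lemma lm_grad_le : norm2 g <= (B ^+ 2 + gam) * norm2 d.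
Proof.
apply: (norm2_grad_le Hd (ltW B0)) => // v.
by apply: norm2_JCv (ltW B0) (HB Kx).
Qed.

(** Minimality of [i] at [x] and of [j] at [x + d] compares the two increments. The one of [i] is at
    most [- 2 * M] plus an error, the one of [j] at least [dot h d] minus an error, with [h] the new
    gradient; finally [2 * M] is at least [gam * norm2 d ^+ 2], which [lm_grad_le] bounds from
    below. *)
Lemma lm_switch_bound j :
  Imin F C x i -> Imin F C (x + d) j -> norm2 d < eta ->
  norm2 g - (B ^+ 2 + 2 * L) * norm2 d <= norm2 (grad (fsum F C j) (x + d)).
Proof.
move=> Ii Ij de.
have fi : fmin F C x = fsum F C i x by exact: Ii.
have fj : fmin F C (x + d) = fsum F C j (x + d) by exact: Ij.
have fi' := fmin_le i (x + d); have fj' := fmin_le j x.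
have s0 : 0 <= (0 : R) <= 1 by lra.
have s1 : 0 <= (1 : R) <= 1 by lra.
have := short_step_estimate j Kx de s1; have := short_step_estimate i Kx de s0.
rewrite scale0r addr0 scale1r -/g !ler_norml => /andP[_ H1] /andP[H2 _].
set h := grad _ (x + d) in H2 *.
have /andP[H3 _] : - (norm2 h * norm2 d) <= dot h d <= norm2 h * norm2 d.
  by rewrite -ler_norml dot_norm.
have H4 := ler_wpM2r (norm2_ge0 d) lm_grad_le.
have H5 := lm_model_le; rewrite lm_dot_model in H1.
rewrite -(ler_pM2r lm_step_gt0).
by lra.
Qed.

End Trial.

(** The gradient is at most [B] times the residual norm, whose square is [2 * fmin]. This bounds
    [lm_gamma] by a multiple of the damping. *)
Lemma grad_sqr_bound i x : K x -> Imin F C x i ->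
  norm2 (grad (fsum F C i) x) ^+ 2 <= 2 * B ^+ 2 * fmin F C x.
Proof.
move=> Kx Ii; have -> : fmin F C x = fsum F C i x by exact: Ii.
set g := grad _ x; have [->|g0] := eqVneq (norm2 g) 0.
  by rewrite expr0n/= mulr_ge0 ?fsum_ge0// mulr_ge0// sqr_ge0.
have gp : 0 < norm2 g by rewrite lt_neqAle eq_sym g0 norm2_ge0.
have H : norm2 g <= norm2 (FC F C i x) * B.
  rewrite -(ler_pM2r gp) -expr2 norm2_sqr dot_grad_fsum//.
  apply: le_trans (ler_norm _) (le_trans (dot_norm _ _) _).
  rewrite -mulrA ler_wpM2l ?norm2_ge0//.
  exact: norm2_JCv (ltW B0) (HB Kx).
rewrite fsum_FC.
have -> : 2 * B ^+ 2 * (2^-1 * norm2 (FC F C i x) ^+ 2) =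
  (norm2 (FC F C i x) * B) ^+ 2 by field.
by rewrite ler_pXn2r// nnegrE ?norm2_ge0// mulr_ge0 ?norm2_ge0// ltW.
Qed.

End Estimates.
End Algorithm.

(** * Convergence of the gradients *)

Theorem theorem2p6 (R : realType) (m n r p q : nat)
  (t : 'I_r -> 'rV[R]_m) (y : 'I_r -> R) (phi : 'rV[R]_n -> 'rV[R]_m -> R)
  (F : 'I_r -> 'rV[R]_n -> R) (hF : forall k x, F k x = y k - phi x (t k))
  (hC1 : forall k, C1 (F k))
  (hp : (1 <= p <= r)%N)
  (C : 'I_q.+1 -> {set 'I_r}) (hC : enum_psubsets p C)
  (lmin lam0 eps lbar mu : R)
  (hlmin : 0 < lmin) (hlam0 : 0 < lam0) (heps : 0 <= eps)
  (hlbar : 1 < lbar) (hmu : 0 < mu < 1)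
  (x0 : 'rV[R]_n)
  (hbnd : bounded_set [set z | fmin F C z <= fmin F C x0])
  (L : 'I_q.+1 -> R) (hL : forall i, 0 < L i)
  (hlip : forall i, exists U : set 'rV[R]_n,
     [/\ open U, [set z | fmin F C z <= fmin F C x0] `<=` U &
         lipschitz2_on U (L i) (grad (fsum F C i))])
  (x : nat -> 'rV[R]_n) (lam : nat -> R) (ik : nat -> 'I_q.+1)
  (hrun : LM_LOVO_sequence F C lmin lam0 eps lbar mu x0 x lam ik)
  (i : 'I_q.+1) (hinf : infinite_set [set k | ik k = i]) :
  norm2 (grad (fsum F C i) (x k)) @[k --> within [set k | ik k = i] \oo]
    --> (0 : R).
Proof.
have dF k z : differentiable (F k) z by have [+ _] := hC1 k; apply.
set K := [set z | fmin F C z <= fmin F C x0] in hbnd hlip.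
have cK : compact K.
  by apply: bounded_closed_compact => //; exact: closed_fmin_sublevel.
have /choice[U hU] := hlip.
have [B B0 HB] := grad_bound_compact hC1 cK.
have [eta eta0 Heta] : exists2 eta : R, 0 < eta &
    forall j z w, K z -> `|z - w| < eta -> U j w.
  have : \forall e \near (0 : R)^'+, forall j z w, K z -> `|z - w| < e -> U j w.
    apply: filter_forall => j; have [oU KU _] := hU j.
    exact: compact_thickening.
  move=> H; near (0 : R)^'+ => e; exists e; first by [].
  by near: e.
have HU j z w : K z -> norm2 (w - z) < eta -> U j w.
  move=> Kz wz; apply: Heta Kz _; rewrite distrC.
  exact: le_lt_trans (normr_le_norm2 _) wz.
(* One Lipschitz constant for all indices, since the selected index may change at every step. *)
pose Ltot := \sum_j L j.
have LL j : L j <= Ltot.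
  by rewrite /Ltot (bigD1 j)//= lerDl sumr_ge0// => l _; exact: ltW.
have L0 : 0 < Ltot by exact: lt_le_trans (hL ord0) (LL ord0).
have Hlip j : lipschitz2_on (U j) Ltot (grad (fsum F C j)).
  have [_ _ Hj] := hU j; move=> u v Uu Uv; apply: le_trans (Hj _ _ Uu Uv) _.
  by rewrite ler_wpM2r ?norm2_ge0.
have [xx0 lamlam0 run] := hrun.
(* The initial damping may lie below [lmin]. *)
pose l0 := Num.min lmin lam0.
have l00 : 0 < l0 by rewrite lt_min hlmin.
have laml k : l0 <= lam k.
  case: k => [|k]; first by rewrite lamlam0 /l0 ge_min lexx orbT.
  have [_ _ [lam' [d [_ /andP[H _] _]]]] := run k.
  by apply: le_trans H; rewrite le_max ge_min lexx.
have /andP[mu0 mu1] := hmu.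
pose f k := fmin F C (x k).
pose a k := norm2 (grad (fsum F C (ik k)) (x k)).
pose s k := norm2 (x k.+1 - x k).
pose step k lam' d := [/\ lm_trial F C (ik k) (x k) lam' d, l0 <= lam',
  lam k.+1 <= lam', x k.+1 = x k + d &
  [/\ mu * (lm_model F C (ik k) (x k) lam' 0 - lm_model F C (ik k) (x k) lam' d)
    <= f k - f k.+1 &
   forall Lam, lam k <= Lam ->
     (forall l e, 0 < l -> lm_trial F C (ik k) (x k) l e ->
       lm_rho F C (ik k) (x k) l e < mu ->
       lbar * l <= Lam) -> lam' <= Lam]].
have stepP k : exists lam' d, step k lam' d.
  have [_ _ [lam' [d [Hin /andP[_ H] xk]]]] := run k.
  have lk0 : 0 < lam k by exact: lt_le_trans l00 (laml k).
  have [ll Ht Hr HL] := lm_inner_spec hlbar lk0 Hin.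
  exists lam', d; split => //; first exact: le_trans (laml k) ll.
  split=> //; rewrite /f xk -ler_pdivlMr//.
  exact/(lm_model_gt0 hC1 Ht)/(lt_le_trans lk0).
have Ii k : Imin F C (x k) (ik k) by have [] := run k.
have fS k : f k.+1 <= f k.
  have [lam' [d [Ht ll _ _ [H _]]]] := stepP k.
  have := lm_model_gt0 hC1 Ht (lt_le_trans l00 ll) => M0.
  have := mulr_gt0 mu0 M0; lra.
have Kx k : K (x k).
  elim: k => [|k IH]; first by rewrite xx0 /K /=.
  exact: le_trans (fS k) IH.
have B20 : 0 < B ^+ 2 by rewrite exprn_gt0.
(* It suffices to treat the whole sequence; the indices with [ik k = i] are then a restriction. *)
suff H delta : 0 < delta -> exists N, forall k, (N <= k)%N -> a k < delta.
  apply/cvgrPdist_lt => e e0; have [N HN] := H e e0.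
  exists N => // k /= Nk ki; rewrite sub0r normrN ger0_norm ?norm2_ge0//.
  by have := HN k Nk; rewrite /a ki.
move=> delta0.
(* A rejected damping lies below the bound of [lm_rejected_bound]; after one more factor [lbar] it
   is still at most [Lam0]. *)
pose Lam0 := lbar * (8 * Ltot / delta ^+ 2 + 2 / (delta * eta)).
have lbar0 : 0 < lbar by lra.
have grow k : delta / 2 <= a k -> forall lam' d, step k lam' d ->
    Num.min (delta / 8) (l0 * delta ^+ 3 / (32 * B ^+ 2)) * norm2 d <=
    lm_model F C (ik k) (x k) lam' 0 - lm_model F C (ik k) (x k) lam' d.
  move=> ak lam' d [Ht ll _ _ _].
  have lam'0 := lt_le_trans l00 ll.
  apply: (model_growth delta0 B20 l00 (norm2_ge0 d) ak
    (lm_grad_le hC1 B0 HB Ht lam'0 (Kx k)) _ (lm_model_le hC1 Ht)).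
  apply: ler_pM => //; [exact: ltW|by rewrite sqr_ge0|].
  by rewrite ler_pXn2r ?nnegrE ?norm2_ge0// divr_ge0 ?ltW.
(* The factor [mu] turns predicted into actual decrease. The constant [2 * B ^+ 2 * fmin F C x0]
   bounds the squared gradient norm on the level set, so [gamma] is at most [Lam] times it. *)
apply: (@eventually_small_of_descent R a s f lam delta
  (mu * Num.min (delta / 8) (l0 * delta ^+ 3 / (32 * B ^+ 2))) eta
  (B ^+ 2 + 2 * Ltot) Lam0 (2 * B ^+ 2 * fmin F C x0) (B ^+ 2)) => //.
- rewrite mulr_gt0// lt_min !divr_gt0// ?mulr_gt0// exprn_gt0//.
- by rewrite addr_gt0// mulr_gt0.
- rewrite mulr_ge0 ?addr_ge0 ?divr_ge0 ?mulr_ge0 ?sqr_ge0 ?ltW//.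
- by rewrite mulr_ge0 ?fmin_ge0// mulr_ge0 ?sqr_ge0.
- by move=> k; exact: fmin_ge0.
- move=> k ak; have [lam' [d st]] := stepP k.
  have G := grow k ak _ _ st; have [_ _ _ xk [H _]] := st.
  apply: le_trans H; rewrite /s xk addrC addKr -mulrA ler_pM2l//.
- move=> k ak; rewrite /s; have [lam' [d [Ht ll _ xk _]]] := stepP k.
  rewrite {1 2}xk [x k + d]addrC addrK => de.
  have Ij := Ii k.+1; rewrite /a xk; rewrite xk in Ij.
  exact: (lm_switch_bound hC1 L0 B0 HU Hlip HB Ht (lt_le_trans l00 ll)
    (Kx k) (Ii k) Ij de).
- move=> k Lam ak Lam0L lamL.
  have [lam' [d [Ht ll lS xk [_ HL]]]] := stepP k.
  have lam'0 := lt_le_trans l00 ll.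
  have lam'L : lam' <= Lam.
    apply: HL => // l e lp Hl Hrho; apply: le_trans Lam0L; rewrite ler_pM2l//.
    exact: (lm_rejected_bound hC1 L0 eta0 HU Hlip Hl lp (Kx k) (Ii k)
      hmu delta0 ak Hrho).
  split; first exact: le_trans lS lam'L.
  apply: le_trans (lm_grad_le hC1 B0 HB Ht lam'0 (Kx k)) _.
  rewrite /s xk [x k + d]addrC addrK ler_wpM2r ?norm2_ge0// lerD2l.
  have H1 := grad_sqr_bound hC1 B0 HB (Kx k) (Ii k).
  rewrite /lm_gamma; apply: ler_pM => //; [exact: ltW|by rewrite sqr_ge0|].
  apply: le_trans H1 _; rewrite ler_wpM2l//; last exact: (Kx k).
  by rewrite mulr_ge0 ?sqr_ge0.
Unshelve. all: by end_near. Qed.
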